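(* There is an algorithm running in time polynomial in $n$ which, given two compatible strings $X,Y$ of length $n$ with all symbols drawn from $\{0,1,\dots,n-1\}$, computes two compatible binary strings $x,y$ of length polynomial in $n$ such that $D(X,Y)=d(x,y)$.
   Context: The prefix reversal (flip) $f^{(i)}$ applied to a string $s=s_1\cdots s_m$ ($1\le i\le m$) yields $s_i s_{i-1}\cdots s_1 s_{i+1}\cdots s_m$. Two strings are \emph{compatible} if each symbol occurs the same number of times in both. For compatible strings $X,Y$ over an arbitrary alphabet (symbols may repeat), $D(X,Y)$ denotes the minimum number of prefix reversals transforming $X$ into $Y$; for compatible binary strings $x,y$ (words over $\{0,1\}$) this minimum is denoted $d(x,y)$. *)

(* Defs.v *)
From mathcomp Require Import all_boot.
Set Implicit Arguments. Unset Strict Implicit. Unset Printing Implicit Defensive.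

Definition flip (T : Type) (i : nat) (s : seq T) : seq T :=
  rev (take i s) ++ drop i s.

Fixpoint reach (T : Type) (k : nat) (X Y : seq T) : Prop :=
  match k with
  | 0 => X = Y
  | k'.+1 => exists i, 1 <= i <= size X /\ reach k' (flip i X) Y
  end.

Definition flipdist (T : Type) (X Y : seq T) (k : nat) : Prop :=
  reach k X Y /\ forall j, j < k -> ~ reach j X Y.

Definition compatible (T : eqType) (X Y : seq T) : bool := perm_eq X Y.

Definition binary (s : seq nat) : bool := all (fun b => b <= 1) s.

(* ---------- Machine model: unit-cost RAM (add / truncated sub,
   indirect addressing), polynomially equivalent to Turing machines ---- *)

Inductive instr : Type :=
  | IConst of nat & nat
  | IAdd of nat & nat & nat
  | ISub of nat & nat & nat
  | ILoad of nat & nat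
  | IStore of nat & nat
  | IJz of nat & nat
  | IJmp of nat
  | IHalt.

Definition program := seq instr.
Definition memory := nat -> nat.
Definition config : Type := (nat * memory)%type.

Definition upd (m : memory) (r v : nat) : memory :=
  fun j => if j == r then v else m j.

Definition step (P : program) (c : config) : option config :=
  let: (pc, m) := c in
  match nth IHalt P pc with
  | IConst r k => Some (pc.+1, upd m r k)
  | IAdd r a b => Some (pc.+1, upd m r (m a + m b))
  | ISub r a b => Some (pc.+1, upd m r (m a - m b))
  | ILoad r a => Some (pc.+1, upd m r (m (m a)))
  | IStore a r => Some (pc.+1, upd m (m a) (m r))
  | IJz r l => Some (if m r == 0 then l else pc.+1, m)
  | IJmp l => Some (l, m)
  | IHalt => None
  end.

Fixpoint run (P : program) (t : nat) (c : config) : option memory :=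
  match step P c with
  | None => Some c.2
  | Some c' => if t is t'.+1 then run P t' c' else None
  end.

Definition init_mem (X Y : seq nat) : memory :=
  fun j => if j == 0 then size X
           else if j <= size X then nth 0 X j.-1
           else if j <= size X + size Y then nth 0 Y (j.-1 - size X)
           else 0.

Definition out_x (m : memory) : seq nat := mkseq (fun i => m i.+1) (m 0).
Definition out_y (m : memory) : seq nat := mkseq (fun i => m (m 0 + i.+1)) (m 0).

(* Main.v *)
Require Import Defs.
From Stdlib Require Import FunctionalExtensionality.
From mathcomp Require Import all_boot.
From mathcomp Require Import zify.
Set Implicit Arguments. Unset Strict Implicit. Unset Printing Implicit Defensive.

(** Encode a symbol [a] as [N = 32 n] copies of the palindrome [1 0^(2a+2) 1].
    Since encodings of symbols are palindromes, a flip of [X] is realised by one flip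
    of its encoding, and [D(X,Y) <= 2n].

    Conversely, a flip of a binary string cuts at most one copy, so a sequence of
    [k < N] flips leaves all but [k] copies uncut, and an uncut copy of [1 0^(2a+2) 1]
    can only end up exactly on a copy of the same word in the encoding of [Y].
    Counting copies gives Hall's condition for the relation "some uncut copy of symbol
    [i] of [X] ends up in the block of symbol [j] of [Y]".  A matching selects
    one uncut copy per symbol of [X]; restricting the flips to the
    first letters of the selected copies transforms [X] into [Y].

    The RAM program keeps fourteen registers in cells 0 to 13, which hold input at the start
    and output at the end: it first doubles cell 0 into a pointer past the input and saves
    the other cells there, and at the end turns each register into a pointer to its own final
    value and loads it. *)

(** * Hall's marriage theorem *)

(* Among the subfamilies satisfying Hall's condition a minimal one consists of singletons:
   if a member has two elements and neither can be removed, the two violated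
   conditions contradict submodularity (Rado's proof). *)
Lemma hall (A B : finType) (F : A -> {set B}) :
  (forall S : {set A}, #|S| <= #|\bigcup_(a in S) F a|) ->
  exists2 f : A -> B, injective f & forall a, f a \in F a.
Proof.
have [m] := ubnP (\sum_a #|F a|); elim: m => // m IH in F * => ltm hallF.
have F_gt0 a : 0 < #|F a|.
  by have := hallF [set a]; rewrite cards1 big_set1.
have [small|] := boolP [forall a, #|F a| <= 1].
  have F1 a : exists b, F a = [set b].
    by apply/cards1P; rewrite eqn_leq (forallP small) F_gt0.
  have [f fF] := fin_all_exists F1.
  exists f => [a a' eqf|a]; last by rewrite fF set11.
  apply: contraTeq isT => neq; have := hallF [set a; a'].
  by rewrite bigcup_setU !big_set1 !fF eqf setUid cards1 cards2 neq.
rewrite negb_forall => /existsP[a]; rewrite -ltnNge => /card_gt1P[b1 [b2 [Fb1 Fb2 neqb]]].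
pose G b x := if x == a then F a :\ b else F x.
have G_sub b x : G b x \subset F x.
  by rewrite /G; case: eqP => [->|//]; rewrite subD1set.
have [ok|bad] := boolP [exists b in F a, [forall S : {set A}, #|S| <= #|\bigcup_(x in S) G b x|]].
  have /exists_inP[b Fb /forallP okb] := ok.
  case: (IH (G b)) => [|//|f f_inj fG].
    rewrite (bigD1 a) //= -ltnS; apply: leq_trans ltm.
    rewrite [X in _ < X.+1](bigD1 a) //= ltnS /G eqxx [X in _ <= X + _](cardsD1 b) Fb add1n addSn ltnS.
    by rewrite leq_add2l leq_sum // => x /negPf ->.
  by exists f => // x; apply: (subsetP (G_sub b x)).
have viol b : b \in F a -> exists S : {set A},
    a \notin S /\ #|(F a :\ b) :|: \bigcup_(x in S) F x| <= #|S|.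
  move=> Fb; have := bad; rewrite negb_exists => /forallP/(_ b); rewrite Fb /= negb_forall.
  case/existsP=> S; rewrite -ltnNge => ltS; exists (S :\ a); rewrite !inE eqxx; split=> //.
  have bigG (U : {set A}) : a \notin U -> \bigcup_(x in U) G b x = \bigcup_(x in U) F x.
    move=> aU; apply: eq_bigr => x Ux; rewrite /G; case: eqP => // xa.
    by rewrite -xa Ux in aU.
  have [Sa|Sa] := boolP (a \in S); last first.
    by have := hallF S; rewrite leqNgt -(bigG _ Sa) ltS.
  move: ltS; rewrite (big_setD1 a) //= bigG ?inE ?eqxx // {1}/G eqxx.
  by rewrite [#|S|](cardsD1 a) Sa.
have [S1 [aS1 le1]] := viol _ Fb1; have [S2 [aS2 le2]] := viol _ Fb2.
set U1 := _ :|: _ in le1; set U2 := _ :|: _ in le2.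
(* As [b1] and [b2] differ, each element of [F a] survives in [U1] or in [U2]. *)
have leU : #|\bigcup_(x in a |: (S1 :|: S2)) F x| <= #|U1 :|: U2|.
  apply/subset_leq_card/bigcupsP => x; rewrite !inE => /or3P[/eqP->|Sx|Sx]; apply/subsetP=> b Fb.
  - rewrite /U1 /U2 !inE Fb !andbT; case: (eqVneq b b1) => [->|] //=.
    by rewrite neqb !orbT.
  - by rewrite !inE; apply/orP; left; apply/orP; right; apply/bigcupP; exists x.
  - by rewrite !inE; apply/orP; right; apply/orP; right; apply/bigcupP; exists x.
have leI : #|\bigcup_(x in S1 :&: S2) F x| <= #|U1 :&: U2|.
  apply/subset_leq_card/bigcupsP => x; rewrite !inE => /andP[x1 x2]; apply/subsetP=> b Fb.
  by rewrite !inE; apply/andP; split; apply/orP; right; apply/bigcupP; exists x.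
(* Adding the two conditions bounds [#|S1| + #|S2| + 1] by [#|U1| + #|U2|], which is at most
   [#|S1| + #|S2|]. *)
have := hallF (a |: (S1 :|: S2)); have := hallF (S1 :&: S2).
rewrite cardsU1 !inE negb_or aS1 aS2 /=.
have := cardsUI U1 U2; have := cardsUI S1 S2; lia.
Qed.

(** * Prefix reversals *)

Lemma map_flip (T U : Type) (f : T -> U) i s : map f (flip i s) = flip i (map f s).
Proof. by rewrite /flip map_cat map_rev map_take map_drop. Qed.

Lemma filter_flip (T : Type) (p : pred T) i s :
  filter p (flip i s) = flip (count p (take i s)) (filter p s).
Proof.
have -> : filter p s = filter p (take i s) ++ filter p (drop i s).
  by rewrite -filter_cat cat_take_drop.
by rewrite /flip filter_cat filter_rev -size_filter take_size_cat ?drop_size_cat.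
Qed.

Lemma flip1 (T : Type) (s : seq T) : flip 1 s = s.
Proof. by case: s => // x s; rewrite /flip /= take0 drop0. Qed.

Lemma perm_flip (T : eqType) i (s : seq T) : perm_eq (flip i s) s.
Proof. by rewrite /flip -{3}[s](cat_take_drop i) perm_cat2r perm_rev. Qed.

Lemma reach_perm (T : eqType) k (s t : seq T) : reach k s t -> perm_eq s t.
Proof.
elim: k s => [s -> //|k IH s /= [i [_ /IH]]].
by apply: perm_trans; rewrite perm_sym perm_flip.
Qed.

Lemma reach_map (T U : Type) (f : T -> U) k s t :
  reach k s t -> reach k (map f s) (map f t).
Proof.
elim: k s => [s -> //|k IH s /= [i [le_i /IH st]]].
by exists i; rewrite size_map -map_flip.
Qed.

Lemma reach_map_inv (T U : Type) (f : T -> U) k s y :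
  reach k (map f s) y -> exists2 t, reach k s t & map f t = y.
Proof.
elim: k s => [s /= <-|k IH s /= [i []]]; first by exists s.
rewrite size_map -map_flip => le_i /IH[t st ft].
by exists t => //; exists i.
Qed.

(** A flip whose prefix has no selected letter would restrict to a flip of length 0, which [reach]
    forbids; the identity [flip 1] replaces it, and is legal because some letter is selected. *)
Lemma reach_filter (T : eqType) (p : pred T) k s t :
  has p s -> reach k s t -> reach k (filter p s) (filter p t).
Proof.
elim: k s => [s _ -> //|k IH s ps /= [i [_ /IH]]].
rewrite (perm_has _ (perm_flip i s)) filter_flip => /(_ ps).
set c := count _ _ => st; case: (posnP c) => c0.
  exists 1; rewrite flip1; split; first by rewrite size_filter -has_count.
  by move: st; rewrite c0 /flip take0 drop0.
exists c; split=> //; rewrite c0 size_filter /c -{2}[s](cat_take_drop i) count_cat.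
by rewrite leq_addr.
Qed.

Lemma reach_cat (T : Type) k k' (s t v : seq T) :
  reach k s t -> reach k' t v -> reach (k + k') s v.
Proof.
elim: k s => [s -> //|k IH s /= [i [le_i /IH st]] tv].
by exists i; split=> //; apply: st.
Qed.

Lemma reach_rcons (T : Type) k (s t : seq T) y :
  reach k s t -> reach k (rcons s y) (rcons t y).
Proof.
elim: k s => [s -> //|k IH s /= [i [/andP[i0 le_i] /IH st]]]; exists i.
split; first by rewrite size_rcons i0 leqW.
suff -> : flip i (rcons s y) = rcons (flip i s) y by [].
rewrite /flip -cats1 takel_cat // drop_cat -cats1 -catA.
by move: le_i; case: ltngtP => // -> _; rewrite subnn drop_size.
Qed.

(** Pancake sorting: one flip brings the last symbol of the target to the front, a flip of the whole
    string sends it to the end, and induction treats the rest. *)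
Lemma perm_reach (T : eqType) (s t : seq T) :
  perm_eq s t -> exists2 k, k <= 2 * size s & reach k s t.
Proof.
elim/last_ind: t s => [|t y IH] s st.
  by exists 0 => //=; move: st => /perm_nilP ->.
have ys : y \in s by rewrite (perm_mem st) mem_rcons mem_head.
case/splitPr: ys st => s1 s2 st.
have s't : perm_eq (rev s2 ++ s1) t.
  rewrite -(perm_cons y) perm_sym -perm_rcons perm_sym.
  apply: perm_trans st.
  by rewrite perm_sym perm_catC /= perm_cons perm_cat2r perm_sym perm_rev.
have [k le_k r_k] := IH _ s't.
exists (2 + k).
  by move: le_k; rewrite !size_cat size_rev /=; lia.
apply: (@reach_cat _ 2 k _ (rcons (rev s2 ++ s1) y)); last exact: reach_rcons.
exists (size s1).+1; split; first by rewrite size_cat /= addnS ltnS leq_addr.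
have -> : flip (size s1).+1 (s1 ++ y :: s2) = y :: rev s1 ++ s2.
  by rewrite -cat_rcons /flip -(size_rcons s1 y) take_size_cat // drop_size_cat // rev_rcons.
exists (size (y :: rev s1 ++ s2)); split; first by rewrite leqnn.
by rewrite /reach /flip take_size drop_size cats0 rev_cons rev_cat revK.
Qed.

(** * Code words and the binary encoding *)

Definition code (a : nat) : seq nat := 1 :: rcons (nseq (2 * a + 2) 0) 1.
Definition encode (N : nat) (X : seq nat) : seq nat :=
  flatten [seq flatten (nseq N (code a)) | a <- X].

Lemma size_code a : size (code a) = 2 * a + 4.
Proof. by rewrite /= size_rcons size_nseq; lia. Qed.

Lemma nth_code a i : nth 0 (code a) i = (i == 0) || (i == 2 * a + 3).
Proof.
case: i => [//|i] /=; rewrite nth_rcons size_nseq nth_nseq if_same.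
case: ltngtP; lia.
Qed.

Lemma rev_code a : rev (code a) = code a.
Proof. by rewrite /code rev_cons rev_rcons rev_nseq. Qed.

Lemma rev_encode N X : rev (encode N X) = encode N (rev X).
Proof.
rewrite /encode rev_flatten -map_comp -map_rev; congr flatten; apply: eq_map => a /=.
by rewrite rev_flatten map_nseq rev_nseq rev_code.
Qed.

Lemma encode_cat N X Y : encode N (X ++ Y) = encode N X ++ encode N Y.
Proof. by rewrite /encode map_cat flatten_cat. Qed.

Lemma size_encode_gt0 N X : 0 < N -> 0 < size X -> 0 < size (encode N X).
Proof. by case: N X => // N [|a X] //= _ _; rewrite /encode /= !size_cat. Qed.

Lemma reach_encode N k X Y : 0 < N -> reach k X Y -> reach k (encode N X) (encode N Y).
Proof.
move=> N0; elim: k X => [X -> //|k IH X /= [i [/andP[i0 le_i] /IH XY]]].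
have eX : encode N X = encode N (take i X) ++ encode N (drop i X).
  by rewrite -encode_cat cat_take_drop.
exists (size (encode N (take i X))); split.
  by rewrite size_encode_gt0 ?size_takel //= eX size_cat leq_addr.
suff -> : flip (size (encode N (take i X))) (encode N X) = encode N (flip i X) by [].
by rewrite /flip eX encode_cat -rev_encode take_size_cat // drop_size_cat.
Qed.

(** Ones occur only at the ends of code words, with at least two zeros between them, so an
    occurrence of a code word can neither straddle a boundary nor lie properly inside another
    word. *)
Lemma code_flatten_align (Q : eqType) (sym : Q -> nat) (W : seq Q) C a E :
  flatten [seq code (sym q) | q <- W] = C ++ code a ++ E ->
  exists W1 q W2, [/\ W = W1 ++ q :: W2, sym q = a
                    & C = flatten [seq code (sym q) | q <- W1]].
Proof.
elim: W C => [|q W IH] C /= eqW; first by case: C eqW.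
have {}eqW : code (sym q) ++ flatten [seq code (sym q) | q <- W] = C ++ code a ++ E by [].
set b := sym q in eqW *; set R := flatten _ in eqW IH.
have nthE i : nth 0 (code b ++ R) i = nth 0 (C ++ code a ++ E) i by rewrite eqW.
have nthL i : i < 2 * b + 4 -> nth 0 (code b ++ R) i = (i == 0) || (i == 2 * b + 3).
  by move=> lti; rewrite nth_cat size_code lti nth_code.
have nthR i : i < 2 * a + 4 -> nth 0 (C ++ code a ++ E) (size C + i) = (i == 0) || (i == 2 * a + 3).
  by move=> lti; rewrite nth_cat ltnNge leq_addr addKn nth_cat size_code lti nth_code.
have [C0|C0] := posnP (size C).
  have nth0 i : i < 2 * a + 4 -> nth 0 (code b ++ R) i = (i == 0) || (i == 2 * a + 3).
    by move=> lti; rewrite nthE -nthR // C0.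
  exists [::], q, W; rewrite (size0nil C0); split=> //.
  case: (ltngtP b a) => // ltab; last by have := nth0 (2 * a + 3); rewrite nthL; lia.
  by have := nth0 (2 * b + 3); rewrite nthL; lia.
(* If the occurrence starts inside the first word, its leading one is the closing one of [code b];
   the zero after it would then be the opening one of the next word or lie past the end. *)
have [lt|ge] := ltnP (size C) (2 * b + 4).
  have a0 : 0 < 2 * a + 4 by lia.
  have := nthE (size C); have := nthR 0 a0; rewrite addn0 nthL // => -> e.
  have {}e : size C = 2 * b + 3 by lia.
  have := nthE (size C + 1); rewrite nthR; last by lia.
  rewrite nth_cat size_code e -addnA ltnn subnn.
  have := f_equal size eqW; rewrite !size_cat !size_code e.
  by rewrite /R; case: (W) => [|q' W'] /=; lia.
have eC : C = code b ++ drop (2 * b + 4) C.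
  have := f_equal (take (2 * b + 4)) eqW.
  rewrite -{1}(size_code b) take_size_cat // takel_cat // => ->.
  by rewrite cat_take_drop.
have eR : R = drop (2 * b + 4) C ++ code a ++ E.
  have := f_equal (drop (2 * b + 4)) eqW.
  by rewrite -{1}(size_code b) drop_size_cat // {1}eC -catA -{1}(size_code b) drop_size_cat.
have [W1 [q' [W2 [-> sq eC']]]] := IH _ eR.
by exists (q :: W1), q', W2; split=> //; rewrite eC eC'.
Qed.

(** * Segments that survive a sequence of flips *)

Definition intact (T : Type) (B s : seq T) : Prop :=
  exists C E, s = C ++ B ++ E \/ s = C ++ rev B ++ E.

Lemma intact_rev (T : Type) (B s : seq T) : intact (rev B) s -> intact B s.
Proof. by case=> C [E []]; rewrite ?revK => ->; exists C, E; [right|left]. Qed.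

(* The only segment a flip can destroy is the one containing the last letter of
   the reversed prefix. *)
Lemma intact_flip (P : eqType) (T : Type) (pid : T -> P) (s : seq T) i :
  1 <= i <= size s -> exists p0, forall p B, all (fun t => pid t == p) B ->
  intact B s -> p = p0 \/ intact B (flip i s).
Proof.
case/andP=> i0 le_i; case: s le_i => [|t0 s0]; first by rewrite leqNgt i0.
set s := t0 :: s0 => le_i; exists (pid (nth t0 s i.-1)) => p B allB.
suff main B' : all (fun t => pid t == p) B' -> (exists C E, s = C ++ B' ++ E) ->
    p = pid (nth t0 s i.-1) \/ intact B' (flip i s).
  case=> C [E [eqs|eqs]]; first by apply: main => //; exists C, E.
  case: (main (rev B)); [by rewrite all_rev | by exists C, E | by left |].
  by move/intact_rev; right.
move=> {}allB [C [E eqs]].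
have [le1|gt1] := leqP i (size C).
  right; exists (rev (take i C) ++ drop i C), E; left.
  rewrite /flip eqs takel_cat // -catA; congr (_ ++ _).
  by rewrite -{1}(cat_take_drop i C) -catA drop_size_cat ?size_takel.
have [le2|gt2] := leqP (size C + size B') i.
  right; exists (rev (take (i - (size C + size B')) E)), (rev C ++ drop (i - (size C + size B')) E).
  right; rewrite /flip eqs catA take_cat drop_cat size_cat ltnNge le2 /=.
  by rewrite !rev_cat -!catA.
left; have ltB : i.-1 - size C < size B' by lia.
have -> : nth t0 s i.-1 = nth t0 B' (i.-1 - size C).
  by rewrite eqs nth_cat ltnNge -ltnS prednK // gt1 /= nth_cat ltB.
by move/(all_nthP t0): allB => /(_ _ ltB)/eqP.
Qed.

(** By [intact_flip] each flip contributes one identity to [bad]; segments with any other identity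
    are never cut. *)
Lemma reach_intact (P : eqType) (T : Type) (pid : T -> P) k (s t : seq T) :
  reach k s t -> exists2 bad : seq P, size bad <= k & forall p B, p \notin bad ->
    all (fun x => pid x == p) B -> intact B s -> intact B t.
Proof.
elim: k s => [s ->|k IH s /= [i [le_i /IH[bad szb badP]]]]; first by exists [::].
have [p0 p0P] := intact_flip pid le_i.
exists (p0 :: bad) => // p B; rewrite inE negb_or => /andP[/eqP pp0 pbad] allB iB.
by apply: (badP p) => //; case: (p0P p B allB iB).
Qed.

(** * Tracking the copies of the code words *)

Lemma map_ord_enum (T : Type) (f : nat -> T) n : [seq f (val i) | i <- enum 'I_n] = mkseq f n.
Proof. by rewrite /mkseq -val_enum_ord -map_comp. Qed.

(** The labels [L] of the positions weakly increase, so representatives sitting at positions with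
    their own label are met in increasing order of label; being distinct and exhaustive, these
    labels form [enum 'I_n]. *)
Lemma filter_labels (T : eqType) n (s : seq T) (L : seq 'I_n) (g : T -> 'I_n) (rep : pred T) :
  uniq s -> size L = size s -> sorted leq (map val L) ->
  (forall t, t \in s -> rep t -> nth (g t) L (index t s) = g t) ->
  {in filter rep s &, injective g} ->
  (forall j, exists t, [/\ t \in s, rep t & g t = j]) ->
  map g (filter rep s) = enum 'I_n.
Proof.
move=> us szL sL gL ginj gsurj; apply: (inj_map val_inj).
apply: (sorted_eq leq_trans anti_leq); first 1 last.
- by rewrite val_enum_ord iota_sorted.
- apply/perm_map/uniq_perm; rewrite ?enum_uniq ?map_inj_in_uniq ?filter_uniq // => j.
  rewrite mem_enum inE; apply/mapP; have [t [ts rt <-]] := gsurj j.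
  by exists t; rewrite // mem_filter rt.
have sidx : sorted (relpre (index^~ s) leq) s.
  rewrite -sorted_map (_ : map _ s = iota 0 (size s)) ?iota_sorted //.
  case: s us {szL gL ginj gsurj} => // x0 s us.
  apply: (@eq_from_nth _ 0) => [|i]; rewrite size_map ?size_iota // => lti.
  by rewrite (nth_map x0) // index_uniq // nth_iota.
rewrite sorted_map sorted_map.
have ridx : sorted (relpre (index^~ s) leq) (filter rep s).
  by apply: sorted_filter sidx => y x z; apply: leq_trans.
apply: (@sub_in_sorted _ [pred t | t \in filter rep s]) ridx; last by apply/allP.
move=> t t'; rewrite !inE !mem_filter /= => /andP[rt ts] /andP[rt' ts'] /= le_tt'.
rewrite -(gL t ts rt) -(gL t' ts' rt') (set_nth_default (g t) (g t')) ?szL ?index_mem //.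
rewrite -!(nth_map _ 0 val) ?szL ?index_mem //.
by apply: (sorted_leq_nth leq_trans leqnn) => //; rewrite inE size_map szL index_mem.
Qed.

Lemma pairwise_flatten_map (P T : eqType) (F : P -> seq T) (h : P -> nat) (g : T -> nat) W :
  (forall p t, t \in F p -> g t = h p) -> pairwise (relpre h leq) W ->
  pairwise (relpre g leq) (flatten (map F W)).
Proof.
move=> Fg; elim: W => //= p W IH /andP[pW /IH pwW]; rewrite pairwise_cat pwW andbT.
apply/andP; split.
  apply/allrelP => t u /Fg gt /flatten_mapP[q qW /Fg gu].
  by rewrite /= gt gu; apply: (allP pW).
elim: (F p) (Fg p) => //= t s IHs Fs; rewrite IHs ?andbT => [|u us]; last first.
  by rewrite Fs // inE us orbT.
by apply/allP => u us; rewrite /= !Fs ?inE ?eqxx ?us ?orbT.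
Qed.

(** The pair [(i, c)] names copy [c] of the code word of symbol number [i]. *)
Definition pieces n N : seq ('I_n * 'I_N) := [seq (i, c) | i <- enum 'I_n, c <- enum 'I_N].

Lemma pieces_uniq n N : uniq (pieces n N).
Proof. by apply: allpairs_uniq; rewrite ?enum_uniq // => -[? ?] [? ?]. Qed.

Lemma mem_pieces n N p : p \in pieces n N.
Proof. by case: p => i c; apply: allpairs_f; rewrite mem_enum. Qed.

Section Tagging.
Variables (P : eqType) (sym : P -> nat).

(** Tagging each bit with its copy and its offset makes all letters distinct, so that flips of the
    binary string can be followed letter by letter; [letter] forgets the tags. *)
Definition piece (p : P) : seq (P * nat) := [seq (p, o) | o <- iota 0 (2 * sym p + 4)].
Definition tagging (W : seq P) : seq (P * nat) := flatten [seq piece p | p <- W].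
Definition letter (t : P * nat) : nat := nth 0 (code (sym t.1)) t.2.

Lemma size_piece p : size (piece p) = 2 * sym p + 4.
Proof. by rewrite size_map size_iota. Qed.

Lemma mem_piece p t : (t \in piece p) = (t.1 == p) && (t.2 < 2 * sym p + 4).
Proof.
case: t => q o; apply/mapP/andP => /= [[o']|[/eqP-> lto]].
  by rewrite mem_iota => /andP[_ lto] [-> ->].
by exists o; rewrite // mem_iota.
Qed.

Lemma all_piece p : all (fun t => t.1 == p) (piece p).
Proof. by apply/allP => t; rewrite mem_piece => /andP[]. Qed.

Lemma map_letter_piece p : map letter (piece p) = code (sym p).
Proof. by rewrite -[RHS](mkseq_nth 0) size_code /mkseq /piece -map_comp. Qed.

Lemma map_letter_tagging W : map letter (tagging W) = flatten [seq code (sym p) | p <- W].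
Proof.
rewrite /tagging map_flatten -map_comp; congr flatten; apply: eq_map => p /=.
exact: map_letter_piece.
Qed.

Lemma tagging_uniq W : uniq W -> uniq (tagging W).
Proof.
elim: W => //= p W IH /andP[pW /IH uW]; rewrite /tagging /= cat_uniq uW andbT.
rewrite map_inj_uniq ?iota_uniq //=; last by move=> ? ? [].
apply/hasPn => t /flatten_mapP[q qW]; rewrite !mem_piece => /andP[/eqP-> _].
by apply: contra pW => /andP[/eqP<-].
Qed.

Lemma mem_tagging W t : (t \in tagging W) = (t.1 \in W) && (t.2 < 2 * sym t.1 + 4).
Proof.
apply/flatten_mapP/andP => [[p pW]|[tW lt]].
  by rewrite mem_piece => /andP[/eqP-> ->].
by exists t.1; rewrite ?mem_piece ?eqxx.
Qed.

Lemma tagging_cat W1 W2 : tagging (W1 ++ W2) = tagging W1 ++ tagging W2.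
Proof. by rewrite /tagging map_cat flatten_cat. Qed.

Lemma intact_tagging W p : p \in W -> intact (piece p) (tagging W).
Proof.
case/path.splitPr => W1 W2; exists (tagging W1), (tagging W2); left.
by rewrite tagging_cat.
Qed.

End Tagging.

Lemma encode_pieces N X :
  flatten [seq code (nth 0 X (val p.1)) | p <- pieces (size X) N] = encode N X.
Proof.
rewrite /pieces map_flatten -map_comp /encode.
have -> : [seq flatten (nseq N (code a)) | a <- X] =
  [seq flatten (nseq N (code (nth 0 X (val i)))) | i <- enum 'I_(size X)].
  by rewrite (map_ord_enum (fun i => flatten (nseq N (code (nth 0 X i))))) -{1}(mkseq_nth 0 X) /mkseq -map_comp.
elim: (enum 'I_(size X)) => //= i s IH; rewrite flatten_cat IH; congr (flatten _ ++ _).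
by rewrite -map_comp -[N in RHS]size_enum_ord; elim: (enum 'I_N) => //= c r ->.
Qed.

(** Copy [p] has come to lie exactly in the place of copy [q] of the target. A permutation of the
    piece is asked for because it may arrive reversed. *)
Definition lands (P : eqType) (sx sy : P -> nat) (W : seq P) (s : seq (P * nat)) (p q : P) : Prop :=
  exists C B E, [/\ q \in W, sy q = sx p, s = C ++ B ++ E, perm_eq B (piece sx p)
                  & size C = size (tagging sy (take (index q W) W))].

(** The code word is a palindrome, so an intact piece spells it in either orientation, and
    [code_flatten_align] forces it onto a code word of the target. *)
Lemma intact_lands (P : eqType) (sx sy : P -> nat) W s p :
  uniq W -> map (letter sx) s = flatten [seq code (sy q) | q <- W] ->
  intact (piece sx p) s -> exists q, lands sx sy W s p q.
Proof.
move=> uW eqy [C [E CE]].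
have [B [permB mapB eqs]] : exists B, [/\ perm_eq B (piece sx p),
    map (letter sx) B = code (sx p) & s = C ++ B ++ E].
  case: CE => ->; [exists (piece sx p) | exists (rev (piece sx p))];
  by rewrite ?perm_rev ?map_rev map_letter_piece ?rev_code.
move: eqy; rewrite eqs !map_cat mapB => /esym/code_flatten_align[W1 [q [W2 [eqW sq eqC]]]].
exists q, C, B, E; split=> //; first by rewrite eqW mem_cat mem_head orbT.
rewrite -(size_map (letter sx)) eqC -(map_letter_tagging sy) size_map.
rewrite eqW take_pivot //; move: uW; rewrite eqW cat_uniq => /and3P[_ + _].
by apply: contra => qW1; apply/hasP; exists q; rewrite ?mem_head.
Qed.

(** Two pieces in the same place share the first letter there, and its tag names the piece. *)
Lemma lands_inj (P : eqType) (sx sy : P -> nat) W s p p' q :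
  lands sx sy W s p q -> lands sx sy W s p' q -> p = p'.
Proof.
case=> C [B [E [_ _ -> pB szC]]] [C' [B' [E' [_ _ eqs pB' szC']]]].
have szB : 0 < size B by rewrite (perm_size pB) size_piece addn4.
have szB' : 0 < size B' by rewrite (perm_size pB') size_piece addn4.
case: B => // t B in pB eqs szB *; case: B' => // t' B' in pB' eqs szB' *.
have tt' : t = t'.
  have := f_equal (fun z => nth t z (size C)) eqs.
  by rewrite /= [LHS]nth_cat [in RHS]szC -szC' [RHS]nth_cat !ltnn !subnn.
have := mem_head t B; rewrite (perm_mem pB) mem_piece => /andP[/eqP <- _].
by have := mem_head t' B'; rewrite (perm_mem pB') mem_piece tt' => /andP[/eqP <- _].
Qed.

Lemma lands_label (P : eqType) (sx sy : P -> nat) W s p q t0 o :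
  uniq s -> lands sx sy W s p q -> o < 2 * sx p + 4 ->
  (p, o) \in s /\ (nth t0 (tagging sy W) (index (p, o) s)).1 = q.
Proof.
move=> us [C [B [E [qW sq eqs pB szC]]]] lto.
have tB : (p, o) \in B by rewrite (perm_mem pB) mem_piece eqxx.
have ts : (p, o) \in s by rewrite eqs !mem_cat tB orbT.
split=> //.
have tC : (p, o) \notin C.
  move: us; rewrite eqs cat_uniq => /and3P[_ /hasPn + _] => /(_ (p, o)); apply.
  by rewrite mem_cat tB.
rewrite eqs index_cat (negPf tC) index_cat tB szC.
have {1}-> : W = take (index q W) W ++ q :: drop (index q W).+1 W.
  by rewrite -{2}(nth_index q qW) -drop_nth ?index_mem // cat_take_drop.
rewrite tagging_cat nth_cat ltnNge leq_addr addKn nth_cat size_piece sq.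
rewrite -(size_piece sx) -(perm_size pB) index_mem tB.
have : nth t0 (piece sy q) (index (p, o) B) \in piece sy q.
  by apply: mem_nth; rewrite size_piece sq -(size_piece sx) -(perm_size pB) index_mem.
by rewrite mem_piece => /andP[/eqP].
Qed.

Lemma sorted_blocks n N (sym : 'I_n * 'I_N -> nat) :
  sorted leq [seq val t.1.1 | t <- tagging sym (pieces n N)].
Proof.
rewrite sorted_map; apply: pairwise_sorted.
apply: (pairwise_flatten_map (h := fun p => val p.1)) => [p t|].
  by rewrite mem_piece => /andP[/eqP->].
apply: (pairwise_flatten_map (h := val)) => [i p /mapP[c _ ->] //|].
rewrite -pairwise_map val_enum_ord -sorted_pairwise ?iota_sorted //.
exact: leq_trans.
Qed.

(** * Recovering flips of symbols from flips of bits *)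

Lemma reach_decode N k X Y :
  0 < size X -> size X = size Y -> k < N ->
  reach k (encode N X) (encode N Y) -> reach k X Y.
Proof.
move=> X0 eq_sz ltkN; set n := size X.
pose W := pieces n N; pose sx (p : 'I_n * 'I_N) := nth 0 X p.1.
pose sy (p : 'I_n * 'I_N) := nth 0 Y p.1.
have eX : encode N X = map (letter sx) (tagging sx W).
  by rewrite map_letter_tagging encode_pieces.
have eY : encode N Y = flatten [seq code (sy q) | q <- W].
  by rewrite -encode_pieces /sy /W /n eq_sz.
(* Flips act on positions only, so they lift from bits to tagged letters. *)
rewrite eX => /reach_map_inv[s rs es]; rewrite {}eY in es.
set s0 := tagging sx W in rs.
have us0 : uniq s0 by rewrite tagging_uniq ?pieces_uniq.
have ps := reach_perm rs.
have us : uniq s by rewrite -(perm_uniq ps).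
have [bad szbad badP] := reach_intact fst rs.
(* The condition stands under the existential so that a total function [f] can be chosen; cut copies
   get a dummy value. *)
have landP p : exists q, p \notin bad -> lands sx sy W s p q.
  have [pbad|pok] := boolP (p \in bad); first by exists p.
  have [q lq] : exists q, lands sx sy W s p q; last by exists q.
  apply: intact_lands => //; first exact: pieces_uniq.
  apply: (badP p) => //; first exact: all_piece.
  by apply: intact_tagging; rewrite mem_pieces.
have [f fP] := fin_all_exists landP.
pose F (i : 'I_n) := [set (f p).1 | p in [set p | (p.1 == i) && (p \notin bad)]].
(* Hall's condition: at least [#|S| * N - k] uncut copies belong to [S], and they land injectively
   on [#|U| * N] places, so [#|U| < #|S|] would give [N <= k]. *)
have [S|sg sg_inj sgF] := @hall _ _ F.
  pose U := \bigcup_(i in S) F i.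
  pose G := [set p : 'I_n * 'I_N | (p.1 \in S) && (p \notin bad)].
  have leGU : #|G| <= #|U| * N.
    rewrite -[N in _ * N]card_ord -cardsT -cardsX -(card_in_imset (f := f)).
      apply/subset_leq_card/subsetP => _ /imsetP[p + ->]; rewrite !inE => /andP[pS pok].
      rewrite andbT; apply/bigcupP; exists p.1 => //.
      by apply/imsetP; exists p; rewrite // inE eqxx.
    move=> p p'; rewrite !inE => /andP[_ pok] /andP[_ pok'] eqf.
    by apply: (lands_inj (fP p pok)); rewrite eqf; apply: fP.
  have leSG : #|S| * N <= #|G| + k.
    rewrite -[N in _ * N]card_ord -cardsT -cardsX.
    apply: (@leq_trans #|G :|: [set p in bad]|).
      by apply/subset_leq_card/subsetP => p; rewrite !inE andbT => ->; case: (p \in bad).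
    apply: leq_trans (leq_card_setU _ _) _; rewrite leq_add2l.
    by apply: leq_trans szbad; rewrite cardsE card_size.
  rewrite leqNgt; apply/negP => ltUS.
  have : #|U|.+1 * N <= #|S| * N by rewrite leq_mul2r ltUS orbT.
  by rewrite mulSn; lia.
have pick i : exists c, (i, c) \notin bad /\ (f (i, c)).1 = sg i.
  have /imsetP[[i' c]] := sgF i; rewrite inE /= => /andP[/eqP-> ok] ->.
  by exists c.
have [c cP] := fin_all_exists pick.
(* The opening letter of its selected copy represents each symbol. *)
pose rep (t : 'I_n * 'I_N * nat) := (t.2 == 0) && (t.1.2 == c t.1.1).
have repE t : rep t -> t = (t.1.1, c t.1.1, 0).
  by case: t => -[i d] o /andP[/= /eqP-> /eqP->].
have repi i : rep (i, c i, 0) by rewrite /rep !eqxx.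
have s0i p : (p, 0) \in s0 by rewrite mem_tagging mem_pieces addn4.
have i0 : 'I_n by exists 0.
have labX : map (fun t => t.1.1) (filter rep s0) = enum 'I_n.
  apply: (filter_labels (L := map (fun t => t.1.1) s0)) => //.
  - by rewrite size_map.
  - by rewrite -map_comp; apply: sorted_blocks.
  - by move=> t ts _; rewrite (nth_map t) ?index_mem // nth_index.
  - move=> t t'; rewrite !mem_filter => /andP[rt _] /andP[rt' _] e.
    by rewrite (repE t) // (repE t') // e.
  - by move=> j; exists (j, c j, 0).
have repland t : t \in s -> rep t ->
    (nth t (tagging sy W) (index t s)).1 = f t.1 /\ (f t.1).1 = sg t.1.1.
  move=> ts rt; have [ok fe] := cP t.1.1.
  rewrite (repE t rt) /=; split=> //.
  by apply: (lands_label _ us (fP _ ok) _).2; rewrite addn4.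
(* After the flips the representatives stand in the order of their matched blocks of [Y]. *)
have labY : map (fun t => sg t.1.1) (filter rep s) = enum 'I_n.
  apply: (filter_labels (L := map (fun t => t.1.1) (tagging sy W))) => //.
  - by rewrite size_map -(size_map (letter sy)) map_letter_tagging -es size_map.
  - by rewrite -map_comp; apply: sorted_blocks.
  - move=> t ts rt; have [fe <-] := repland t ts rt.
    rewrite -fe (nth_map t) //.
    by rewrite -(size_map (letter sy)) map_letter_tagging -es size_map index_mem.
  - move=> t t'; rewrite !mem_filter => /andP[rt _] /andP[rt' _] /sg_inj e.
    by rewrite (repE t) // (repE t') // e.
  - move=> j; have [h _ hK] := injF_bij sg_inj.
    by exists (h j, c (h j), 0); rewrite -(perm_mem ps); split; rewrite /= ?hK.
have reps0 : has rep s0 by apply/hasP; exists (i0, c i0, 0).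
pose symX (t : 'I_n * 'I_N * nat) := nth 0 X t.1.1.
have := reach_map symX (reach_filter reps0 rs).
have -> : map symX (filter rep s0) = X.
  rewrite (map_comp (fun i : 'I_n => nth 0 X i) (fun t : 'I_n * 'I_N * nat => t.1.1)) labX.
  by rewrite (map_ord_enum (nth 0 X)) mkseq_nth.
suff -> : map symX (filter rep s) = Y by [].
rewrite -[RHS](mkseq_nth 0) -eq_sz -(map_ord_enum (nth 0 Y)) -labY -map_comp.
apply/eq_in_map => t; rewrite mem_filter => /andP[rt ts] /=.
(* Landing preserves the symbol, so each representative carries the symbol of its block of [Y]. *)
have [_ <-] := repland t ts rt; have [ok _] := cP t.1.1.
have [C [B [E [_ sq _ _ _]]]] := fP _ ok.
by rewrite /symX (repE t rt) /= -[LHS]sq.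
Qed.

(** * The encoding program *)

(** Unlike [run], which answers only at a halt, this counts exact steps and returns a configuration,
    so that program segments compose. *)
Fixpoint exec (P : program) (t : nat) (c : config) : option config :=
  if t is t'.+1 then obind (exec P t') (step P c) else Some c.

Lemma exec_add P t t' c c' :
  exec P t c = Some c' -> exec P (t + t') c = exec P t' c'.
Proof.
elim: t c => [c [->] //|t IH c]; rewrite addSn /=.
by case: (step P c) => //= d; apply: IH.
Qed.

Lemma exec_run P t T c c' :
  exec P t c = Some c' -> step P c' = None -> t <= T -> run P T c = Some c'.2.
Proof.
elim: t T c => [|t IH] T c /=; first by move=> [->] halt _; case: T => [|T] /=; rewrite halt.
case E: (step P c) => [d|] //= ed halt; case: T => // T ltT /=.
by rewrite E; apply: IH.
Qed.

(** * Registers, heap and symbolic execution *)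

Definition mem_of (l : seq nat) (h : memory) : memory :=
  fun j => if j < size l then nth 0 l j else h j.

Lemma mem_of_upd_reg l h r v : r < size l -> upd (mem_of l h) r v = mem_of (set_nth 0 l r v) h.
Proof.
move=> ltr; apply: functional_extensionality => j; rewrite /upd /mem_of size_set_nth nth_set_nth /=.
by rewrite (maxn_idPr ltr); case: eqP => // ->; rewrite ltr.
Qed.

Lemma mem_of_upd_heap l h a v : size l <= a -> upd (mem_of l h) a v = mem_of l (upd h a v).
Proof.
move=> lea; apply: functional_extensionality => j; rewrite /upd /mem_of.
by case: eqP => // ->; rewrite ltnNge lea.
Qed.

Lemma mem_of_reg l h r : r < size l -> mem_of l h r = nth 0 l r.
Proof. by rewrite /mem_of => ->. Qed.

Lemma mem_of_heap l h a : size l <= a -> mem_of l h a = h a.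
Proof. by rewrite /mem_of ltnNge => ->. Qed.

Definition regs_ok (i : instr) : bool :=
  match i with
  | IConst r _ => r < 14
  | IAdd r a b | ISub r a b => [&& r < 14, a < 14 & b < 14]
  | ILoad r a | IStore r a => (r < 14) && (a < 14)
  | IJz r _ => r < 14
  | _ => true
  end.

(* Weakest precondition of [t] steps, for a memory split into fourteen registers
   and a heap that is only accessed through pointers past the registers. *)
Fixpoint wp (P : program) (t pc : nat) (l : seq nat) (h : memory)
    (Q : nat -> seq nat -> memory -> Prop) : Prop :=
  if t is t'.+1 then
    match nth IHalt P pc with
    | IConst r k => wp P t' pc.+1 (set_nth 0 l r k) h Q
    | IAdd r a b => wp P t' pc.+1 (set_nth 0 l r (nth 0 l a + nth 0 l b)) h Q
    | ISub r a b => wp P t' pc.+1 (set_nth 0 l r (nth 0 l a - nth 0 l b)) h Q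
    | ILoad r a => 14 <= nth 0 l a /\ wp P t' pc.+1 (set_nth 0 l r (h (nth 0 l a))) h Q
    | IStore a r => 14 <= nth 0 l a /\ wp P t' pc.+1 l (upd h (nth 0 l a) (nth 0 l r)) Q
    | IJz r k => wp P t' (if nth 0 l r == 0 then k else pc.+1) l h Q
    | IJmp k => wp P t' k l h Q
    | IHalt => False
    end
  else Q pc l h.

Lemma wp_sound P t pc l h Q : all regs_ok P -> size l = 14 -> wp P t pc l h Q ->
  exists pc' l' h', Q pc' l' h' /\ exec P t (pc, mem_of l h) = Some (pc', mem_of l' h').
Proof.
move=> okP; elim: t pc l h => [|t IH] pc l h szl /=; first by exists pc, l, h.
have : regs_ok (nth IHalt P pc).
  have [lt|ge] := ltnP pc (size P); last by rewrite nth_default.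
  exact: (all_nthP _ okP).
have szs r v : r < 14 -> size (set_nth 0 l r v) = 14.
  by move=> ltr; rewrite size_set_nth szl; apply/maxn_idPr.
case: (nth IHalt P pc) => [r k|r a b|r a b|r a|a r|r k|k|] //=.
- by move=> r14 /(IH _ _ _ (szs _ _ r14)); rewrite mem_of_upd_reg ?szl.
- by case/and3P=> r14 a14 b14 /(IH _ _ _ (szs _ _ r14)); rewrite mem_of_upd_reg ?mem_of_reg ?szl.
- by case/and3P=> r14 a14 b14 /(IH _ _ _ (szs _ _ r14)); rewrite mem_of_upd_reg ?mem_of_reg ?szl.
- case/andP=> r14 a14 [le /(IH _ _ _ (szs _ _ r14))].
  by rewrite mem_of_upd_reg ?szl // (mem_of_reg _ (_ : a < size l)) ?mem_of_heap ?szl.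
- case/andP=> a14 r14 [le /(IH _ _ _ szl)].
  by rewrite !mem_of_reg ?szl // mem_of_upd_heap ?szl.
- by move=> r14 /(IH _ _ _ szl); rewrite mem_of_reg ?szl.
- by move=> _ /(IH _ _ _ szl).
Qed.

Definition runs P (t : nat) (s s' : nat * seq nat * memory) : Prop :=
  exists2 k, k <= t & exec P k (s.1.1, mem_of s.1.2 s.2) = Some (s'.1.1, mem_of s'.1.2 s'.2).

Lemma runs_refl P s : runs P 0 s s.
Proof. by exists 0. Qed.

Lemma runs_trans P t t' s s' s'' : runs P t s s' -> runs P t' s' s'' -> runs P (t + t') s s''.
Proof.
move=> [k le e] [k' le' e']; exists (k + k'); first exact: leq_add.
by rewrite (exec_add _ e).
Qed.

Lemma runs_le P t t' s s' : runs P t s s' -> t <= t' -> runs P t' s s'.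
Proof. by case=> k le e le'; exists k => //; apply: leq_trans le'. Qed.

Lemma runs_wp P k t pc l h s : all regs_ok P -> size l = 14 ->
  wp P k pc l h (fun pc' l' h' => runs P t (pc', l', h') s) -> runs P (k + t) (pc, l, h) s.
Proof.
move=> okP szl /(wp_sound okP szl)[pc' [l' [h' [r e]]]].
by apply: runs_trans r; exists k.
Qed.

Definition hput (h : memory) (q : nat) (s : seq nat) : memory :=
  fun j => if q <= j < q + size s then nth 0 s (j - q) else h j.

Lemma hput_nil h q : hput h q [::] = h.
Proof. by apply: functional_extensionality => j; rewrite /hput; case: ifP => //=; lia. Qed.

Lemma hput_cat h q q' s s' : q' = q + size s -> hput (hput h q s) q' s' = hput h q (s ++ s').
Proof.
move=> ->; apply: functional_extensionality => j; rewrite /hput size_cat nth_cat.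
case: ifP => c1; first by rewrite ifT 1?ifF ?subnDA //; lia.
by case: ifP => c2; [rewrite ifT 1?ifT //|rewrite ifF //]; lia.
Qed.

Lemma upd_hput h q v : upd h q v = hput h q [:: v].
Proof.
apply: functional_extensionality => j; rewrite /upd /hput /=.
by case: eqP => [->|ne]; [rewrite subnn ifT|rewrite ifF]; rewrite //; lia.
Qed.

Lemma hput_in h q s i : i < size s -> hput h q s (q + i) = nth 0 s i.
Proof. by move=> lt; rewrite /hput leq_addr ltn_add2l lt addKn. Qed.

Lemma hput_out h q s j : j < q \/ q + size s <= j -> hput h q s j = h j.
Proof. by move=> out; rewrite /hput ifF //; lia. Qed.

Definition copy_loop (o : nat) : program :=
  [:: IJz 4 (o + 7); ILoad 5 2; IStore 3 5; IAdd 2 2 1; IAdd 3 3 1; ISub 4 4 1; IJmp o].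

(* Registers: 0 half of the output length, 1 the constant one, 2 and 3 source and
   destination, 4 a counter, 5 a temporary, 6 the current symbol plus one, 7 and 8 inner
   counters, 9 the number [32 n] of copies, 10 and 11 constants, 12 and 13 start and end of
   the output.  The counter of the loop over the [2 n] input symbols starts at [32 n] and
   decreases by 16, so that [2 n] itself need not be stored.  Marked positions are jump
   targets. *)
Definition prog : program :=
  [:: IJz 0 121; IAdd 0 0 0; IAdd 0 0 0; IAdd 0 0 0; IAdd 0 0 0; IAdd 0 0 0;
      IStore 0 1; IConst 1 1]
  ++ flatten [seq [:: IAdd 0 0 1; IStore 0 r] | r <- iota 2 12]
  ++ [:: IConst 10 0; IConst 11 12; ISub 9 0 11; IConst 2 14; IAdd 3 0 1; ISub 4 9 2;
      IConst 11 16]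
  ++ copy_loop 39
  ++ [:: IAdd 12 3 10; IAdd 13 3 10; IAdd 2 9 10; IAdd 4 9 10; IConst 0 0;
      (* 51 *) IJz 4 74; ILoad 6 2; IAdd 6 6 1; IAdd 2 2 1; ISub 4 4 11; IAdd 7 9 10;
      (* 57 *) IJz 7 51; ISub 7 7 1; IStore 13 1; IAdd 13 13 1; IAdd 8 6 10;
      (* 62 *) IJz 8 70; ISub 8 8 1; IStore 13 10; IAdd 13 13 1; IStore 13 10; IAdd 13 13 1;
      IAdd 0 0 1; IJmp 62;
      (* 70 *) IStore 13 1; IAdd 13 13 1; IAdd 0 0 1; IJmp 57;
      (* 74 *) IAdd 2 12 10; IAdd 3 13 10; IConst 4 13]
  ++ copy_loop 77
  ++ [:: ISub 13 3 1; IConst 3 14; IAdd 4 0 0; IConst 5 13; ISub 4 4 5]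
  ++ copy_loop 89
  ++ [seq ISub r r.+1 1 | r <- rev (iota 1 12)]
  ++ [seq ILoad r r | r <- iota 1 13]
  ++ [:: IHalt].

(** * Correctness and running time of the program, phase by phase *)

Lemma runs_to P t s pc l h l' h' :
  runs P t s (pc, l, h) -> l = l' -> h = h' -> runs P t s (pc, l', h').
Proof. by move=> r <- <-. Qed.

Lemma runs_from P t pc l h l' h' s :
  runs P t (pc, l', h') s -> l = l' -> h = h' -> runs P t (pc, l, h) s.
Proof. by move=> r -> ->. Qed.

(* To be applied to a few steps at a time: simplifying nested register updates is
   exponential in their number. *)
Ltac sym_exec :=
  match goal with |- runs _ _ _ ?s => let S := fresh "S" in set S := s;
    apply: runs_wp; [by [] | by [] | rewrite /=; rewrite /S {S}] end.

Ltac regs_eq := repeat (apply: (f_equal2 cons); first lia); reflexivity.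

(** Copying proceeds upwards, so under [ovl] no source cell is overwritten before it is read. The
    offsets are the three places of [copy_loop] in [prog]; concrete ones let execution compute. *)
Lemma copy_runs o a b c L d s6 s7 s8 s9 s10 s11 s12 s13 h :
  o \in [:: 39; 77; 89] -> 14 <= a -> 14 <= b -> a + c <= b \/ b <= a ->
  exists t, runs prog (7 * c + 1)
    (o, [:: L; 1; a; b; c; d; s6; s7; s8; s9; s10; s11; s12; s13], h)
    (o + 7, [:: L; 1; a + c; b + c; 0; t; s6; s7; s8; s9; s10; s11; s12; s13],
     hput h b (mkseq (fun i => h (a + i)) c)).
Proof.
move=> oP; elim: c a b d h => [|c IH] a b d h a14 b14 ovl.
  exists d; rewrite hput_nil !addn0; apply: (@runs_wp _ 1 0) => //.
  by move: oP; rewrite !inE => /or3P[] /eqP->; apply: runs_refl.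
have [t IHt] := IH (a + 1) (b + 1) (h a) (upd h b (h a)) ltac:(lia) ltac:(lia) ltac:(lia).
exists t; apply: runs_le (_ : 7 + (7 * c + 1) <= _); last by lia.
suff: runs prog (7 * c + 1)
    (o, [:: L; 1; a + 1; b + 1; c.+1 - 1; h a; s6; s7; s8; s9; s10; s11; s12; s13], upd h b (h a))
    (o + 7, [:: L; 1; a + c.+1; b + c.+1; 0; t; s6; s7; s8; s9; s10; s11; s12; s13],
     hput h b (mkseq (fun i => h (a + i)) c.+1)).
  by move: oP => {IHt}; rewrite !inE => /or3P[] /eqP-> r; sym_exec.
rewrite subn1; apply: runs_to IHt _ _; first by regs_eq.
rewrite upd_hput hput_cat //=; congr hput.
rewrite /mkseq /= addn0 -[iota 1 c]/(iota (1 + 0) c) iotaDl -map_comp; congr cons.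
apply/eq_in_map => i; rewrite mem_iota /= => lti; rewrite hput_out /=; last by lia.
by congr h; lia.
Qed.

Lemma inner_runs z L p d cnt t s c n H q h : 14 <= q ->
  runs prog (8 * z + 1) (62, [:: L; 1; p; d; cnt; t; s; c; z; n; 0; 16; H; q], h)
   (70, [:: L + z; 1; p; d; cnt; t; s; c; 0; n; 0; 16; H; q + 2 * z], hput h q (nseq (2 * z) 0)).
Proof.
elim: z L q h => [|z IH] L q h q14.
  by rewrite hput_nil !addn0; apply: (@runs_wp _ 1 0) => //; apply: runs_refl.
apply: runs_le (_ : 8 + (8 * z + 1) <= _); last by lia.
sym_exec; rewrite subn1; split=> //; split; first by lia.
apply: runs_to (IH _ _ _ _) _ _; first by lia.
  by regs_eq.
by rewrite mulnS !upd_hput !hput_cat.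
Qed.

(** Register 6 holds [a.+1], so the inner loop writes [2 * a + 2] zeros and adds [a.+1] to register
    0; the closing one adds the last unit of the half length [a + 2]. *)
Lemma mid_runs c a L p d cnt t z n H q h : 14 <= q ->
  exists z', runs prog (c * (8 * a + 18) + 1)
   (57, [:: L; 1; p; d; cnt; t; a.+1; c; z; n; 0; 16; H; q], h)
   (51, [:: L + c * (a + 2); 1; p; d; cnt; t; a.+1; 0; z'; n; 0; 16; H; q + 2 * (c * (a + 2))],
     hput h q (flatten (nseq c (code a)))).
Proof.
elim: c L z q h => [|c IH] L z q h q14.
  exists z; rewrite hput_nil !addn0; apply: (@runs_wp _ 1 0) => //; exact: runs_refl.
have q14' : 14 <= q + 1 + 2 * a.+1 + 1 by lia.
have [z' IHz] := IH (L + a.+1 + 1) 0 _ (hput h q (code a)) q14'.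
exists z'; apply: runs_le (_ : 5 + ((8 * a.+1 + 1) + (4 + (c * (8 * a + 18) + 1))) <= _); last by lia.
sym_exec; rewrite addn0 subn1 /=; split=> //; apply: runs_trans; first by apply: inner_runs; lia.
sym_exec; split; first by lia.
have -> : upd (hput (upd h q 1) (q + 1) (nseq (2 * a.+1) 0)) (q + 1 + 2 * a.+1) 1 = hput h q (code a).
  rewrite !upd_hput !hput_cat //=; last by rewrite size_nseq; lia.
  by congr (hput _ _ (1 :: _)); rewrite -cats1 (_ : 2 * a + 2 = 2 * a.+1) //; lia.
apply: runs_to IHz _ _; first by regs_eq.
by rewrite hput_cat // size_code; lia.
Qed.

(** Half the length of the encoding, code words having even length. For [X ++ Y] it is the common
    length of the two outputs, which must end up in cell 0. *)
Definition weight (n : nat) (Z : seq nat) : nat := sumn [seq n * (a + 2) | a <- Z].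

Lemma size_encode n Z : size (encode n Z) = 2 * weight n Z.
Proof.
rewrite /encode /weight; elim: Z => //= a Z IH; rewrite size_cat IH mulnDr; congr (_ + _).
by rewrite size_flatten /shape map_nseq sumn_nseq size_code; lia.
Qed.

(** The output starts past the input, so writing never disturbs symbols still to be read. The bound
    [b] gives a uniform time per symbol. *)
Lemma outer_runs Z b L p d t s c z n H q h :
  all (fun a => a < b) Z -> (forall i, i < size Z -> h (p + i) = nth 0 Z i) ->
  14 <= p -> p + size Z <= q ->
  exists s' c' z', runs prog (size Z * (n * (8 * b + 18) + 7) + 1)
   (51, [:: L; 1; p; d; 16 * size Z; t; s; c; z; n; 0; 16; H; q], h)
   (74, [:: L + weight n Z; 1; p + size Z; d; 0; t; s'; c'; z'; n; 0; 16; H; q + 2 * weight n Z],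
    hput h q (encode n Z)).
Proof.
elim: Z L p s c z q h => [|a Z IH] L p s c z q h.
  exists s, c, z; rewrite hput_nil !addn0; apply: (@runs_wp _ 1 0) => //; exact: runs_refl.
move=> /= /andP[ab Zb] hZ p14 pq.
have h0 : h p = a by rewrite -[p]addn0 hZ.
have q14 : 14 <= q by lia.
have [z1 r1] := mid_runs n a L (p + 1) d (16 * size Z) t z n H h q14.
have [||||s' [c' [z' r2]]] := IH (L + n * (a + 2)) (p + 1) a.+1 0 z1 (q + 2 * (n * (a + 2)))
  (hput h q (flatten (nseq n (code a)))).
- by [].
- move=> i lti; rewrite hput_out; last by lia.
  by rewrite -addnA add1n hZ.
- by lia.
- by lia.
exists s', c', z'.
apply: runs_le (_ : 6 + ((n * (8 * a + 18) + 1) + (size Z * (n * (8 * b + 18) + 7) + 1)) <= _);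
  last first.
  have : n * (8 * a + 18) <= n * (8 * b + 18) by rewrite leq_mul2l; apply/orP; right; lia.
  suff le k u v : v <= u -> 6 + (v + 1 + (k * (u + 7) + 1)) <= k.+1 * (u + 7) + 1 by apply: le.
  by rewrite (mulSn k); lia.
(* The successor form lets the zero test of the counter compute. *)
rewrite (_ : 16 * (size Z).+1 = (16 * size Z + 15).+1); last by lia.
sym_exec; split; first by [].
rewrite h0 !addn0 (addn1 a) (_ : _.+1 - 16 = 16 * size Z); last by lia.
apply: runs_trans r1 _; apply: runs_to r2 _ _; first by rewrite /weight /=; regs_eq.
rewrite hput_cat //; have := size_encode n [:: a].
by rewrite /encode /weight /= cats0 addn0 => ->.
Qed.

(** Five doublings turn cell 0 into the address [32 * n], past both registers and input. Cells 1 to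
    13 are saved there one by one, and the loop copies cells 14 to [32 * n - 1] behind them. *)
Lemma init_runs n (m : memory) : 0 < n -> m 0 = n ->
  exists t', runs prog (100 + 7 * (32 * n))
   (0, mkseq m 14, m)
   (51, [:: 0; 1; 32 * n; 64 * n - 1; 32 * n; t'; m 6; m 7; m 8; 32 * n; 0; 16; 64 * n - 1; 64 * n - 1],
     hput m (32 * n) (mkseq (fun i => m i.+1) (32 * n - 1))).
Proof.
move=> n0 m0.
have [n' en] : exists n', n = n'.+1 by case: (n) n0 => // k; exists k.
set B := 32 * n; have B32 : 32 <= B by lia.
pose h := hput m B [:: m 1; m 2; m 3; m 4; m 5; m 6; m 7; m 8; m 9; m 10; m 11; m 12; m 13].
have [t' r] := @copy_runs 39 14 (B + 13) (B - 14) (B + 12) (m 5) (m 6) (m 7) (m 8) B 0 16 (m 12) (m 13) h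
   isT isT ltac:(lia) ltac:(lia).
exists t'; apply: runs_le (_ : 1 + (5 + (2 + (4 + (4 + (4 + (4 + (4 + (4 + (3 + (4 + ((7 * (B - 14) + 1) + (5 + 0)))))))))))) <= _); last by lia.
rewrite {1}/mkseq [map m _]/= m0 {1}en; sym_exec; rewrite -en.
have eB : (let d x := x + x in d (d (d (d (d n))))) = B by rewrite /= /B; lia.
sym_exec; rewrite /= in eB; rewrite {}eB.
sym_exec; split; first by lia.
do 6 (sym_exec; split; [lia|split; [lia|]]).
sym_exec; sym_exec; apply: runs_trans.
  apply: runs_from r _ _; first by regs_eq.
  by rewrite !upd_hput !hput_cat //=; lia.
sym_exec; apply: runs_to (runs_refl _ _) _ _; first by regs_eq.
rewrite hput_cat //; congr hput; rewrite (_ : B - 1 = 13 + (B - 14)); last by lia.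
rewrite [in RHS]/mkseq iotaD map_cat; congr (_ ++ _).
rewrite [0 + 13]addnC iotaDl -map_comp; apply/eq_in_map => i; rewrite mem_iota => /andP[_ lti] /=.
by rewrite /h hput_out //= /B; lia.
Qed.

(** The first thirteen letters are parked from [Q] on, since their cells still hold registers; the
    others go straight to cells 14 onwards. By [13 <= 2 * W] there are letters enough to fill the
    registers. *)
Lemma final_runs W H Q p d t s c z n E h :
  14 <= H -> 13 <= 2 * W -> size E = 2 * W -> Q = H + 2 * W ->
  exists l' h', [/\ runs prog (7 * (2 * W) + 300)
    (74, [:: W; 1; p; d; 0; t; s; c; z; n; 0; 16; H; Q], hput h H E) (121, l', h'),
    mem_of l' h' 0 = W & forall i, i < 2 * W -> mem_of l' h' i.+1 = nth 0 E i].
Proof.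
move=> H14 W13 szE eQ; set h2 := hput h H E.
have h2E i : i < 2 * W -> h2 (H + i) = nth 0 E i by move=> lti; rewrite /h2 hput_in // szE.
have [t1 r1] := @copy_runs 77 H Q 13 W t s c z n 0 16 H Q h2 isT H14 ltac:(lia) ltac:(lia).
set h3 := hput h2 Q _ in r1.
have h3Q i : i < 13 -> h3 (Q + i) = nth 0 E i.
  by move=> lti; rewrite /h3 hput_in ?size_mkseq // nth_mkseq // h2E //; lia.
have h3H i : i < 2 * W -> h3 (H + i) = nth 0 E i.
  by move=> lti; rewrite /h3 hput_out ?h2E //; lia.
have [t2 r2] := @copy_runs 89 (H + 13) 14 (2 * W - 13) W 13 s c z n 0 16 H (Q + 12) h3
  isT ltac:(lia) isT ltac:(lia).
set h4 := hput h3 14 _ in r2.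
have h4Q i a : a = Q + i -> i < 13 -> h4 a = nth 0 E i.
  by move=> -> lti; rewrite /h4 hput_out ?h3Q // size_mkseq; lia.
have h4lo i : 13 <= i -> i < 2 * W -> h4 i.+1 = nth 0 E i.
  move=> le13 lti; rewrite (_ : i.+1 = 14 + (i - 13)); last by lia.
  rewrite /h4 hput_in ?size_mkseq ?nth_mkseq; try lia.
  by rewrite -addnA h3H; [congr nth|]; lia.
exists (W :: mkseq (nth 0 E) 13), h4; split=> //; last first.
  move=> i lti; rewrite /mem_of [size _]/= ltnS.
  rewrite -[nth 0 (W :: _) _]/(nth 0 (mkseq (nth 0 E) 13) i).
  by case: ltnP => lti13; [rewrite nth_mkseq|apply: h4lo].
apply: (@runs_le _ (3 + ((7 * 13 + 1) + (5 + ((7 * (2 * W - 13) + 1) +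
   (4 + (4 + (4 + (4 + (4 + (5 + 0))))))))))); last by lia.
sym_exec; apply: runs_trans; first by apply: (runs_from r1) => //; regs_eq.
sym_exec; apply: runs_trans; first by apply: (runs_from r2) => //; regs_eq.
(* Registers 12 down to 1 become the addresses [Q + 11] down to [Q]; register 1 comes last because
   it holds the subtracted one. *)
do 3 sym_exec.
do 2 (sym_exec; do 4 (split; [lia|])).
sym_exec; do 5 (split; [lia|]).
apply: runs_to (runs_refl _ _) _ _ => //.
by rewrite /mkseq /=; repeat (apply: (f_equal2 cons); first by [|apply: h4Q; lia]).
Qed.

(** * Polynomial bounds and the reduction *)

Lemma weight_cat n Z1 Z2 : weight n (Z1 ++ Z2) = weight n Z1 + weight n Z2.
Proof. by rewrite /weight map_cat sumn_cat. Qed.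

Lemma weight_le n b Z : all (fun a => a < b) Z -> weight n Z <= size Z * (n * b.+1).
Proof.
rewrite /weight; elim: Z => //= a Z IH /andP[ab /IH le]; rewrite (mulSn (size Z)) leq_add //.
by rewrite leq_mul2l; apply/orP; right; lia.
Qed.

Lemma perm_encode N (X Y : seq nat) : perm_eq X Y -> perm_eq (encode N X) (encode N Y).
Proof. by move=> XY; apply/perm_flatten/perm_map. Qed.

Lemma binary_encode N X : binary (encode N X).
Proof.
apply/allP => b /flattenP[_ /mapP[a _ ->] /flattenP[c]].
rewrite mem_nseq => /andP[_ /eqP->].
by rewrite /code inE mem_rcons inE mem_nseq => /or3P[/eqP->|/eqP->|/andP[_ /eqP->]].
Qed.

Lemma init_mem_nth X Y i : size X = size Y -> i < 2 * size X -> init_mem X Y i.+1 = nth 0 (X ++ Y) i.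
Proof. by move=> szXY lti; rewrite /init_mem /= nth_cat; case: ifP => // _; rewrite ifT //; lia. Qed.

Lemma mem_of_mkseq m k : mem_of (mkseq m k) m = m.
Proof.
apply: functional_extensionality => j; rewrite /mem_of size_mkseq.
by case: ifP => // lt; rewrite nth_mkseq.
Qed.

Lemma prog_correct (X Y : seq nat) (n := size X) :
  perm_eq X Y -> 0 < n -> all (fun a => a < n) X ->
  exists mem, [/\ run prog (n.+1 ^ 15) (0, init_mem X Y) = Some mem,
    out_x mem = encode (32 * n) X, out_y mem = encode (32 * n) Y
    & size (encode (32 * n) X) <= n.+1 ^ 15].
Proof.
move=> XY n0 Xn; set N := 32 * n; set m := init_mem X Y.
have szY : size Y = n by rewrite /n (perm_size XY).
have XYn : all (fun a => a < n) (X ++ Y) by rewrite all_cat -(perm_all _ XY) Xn.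
set W := weight N (X ++ Y).
have szE : size (encode N (X ++ Y)) = 2 * W by apply: size_encode.
have szEX : size (encode N X) = W.
  have := szE; rewrite encode_cat size_cat (perm_size (perm_encode N XY)).
  by rewrite addnn -mul2n => /eqP; rewrite eqn_pmul2l // => /eqP.
have szEY : size (encode N Y) = W by rewrite -(perm_size (perm_encode N XY)).
have leW : W <= 2 * n * (N * n.+1).
  by apply: leq_trans (weight_le _ XYn) _; rewrite size_cat szY -/n addnn mul2n.
have W13 : 13 <= 2 * W.
  suff : N <= weight N X by rewrite /W weight_cat; lia.
  have [a [X' eX]] : exists a X', X = a :: X' by move: n0; rewrite /n; case: (X) => // a X' _; exists a, X'.
  by rewrite eX /weight /= mulnDr; lia.
have [t1 r1] := @init_runs n m n0 (erefl _).
set h1 := hput m _ _ in r1.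
have [|||s' [c' [z' r2]]] := @outer_runs (X ++ Y) n 0 N (2 * N - 1) t1 (m 6) (m 7) (m 8) N (2 * N - 1) (2 * N - 1) h1 XYn.
- move=> i; rewrite size_cat szY -/n => lti.
  rewrite /h1 hput_in ?size_mkseq ?nth_mkseq; try by rewrite ?/N; lia.
  by apply: init_mem_nth; rewrite ?szY // -/n; lia.
- by rewrite /N; lia.
- by rewrite size_cat szY -/n /N; lia.
have [l [h [r3 mem0 memE]]] := @final_runs W (2 * N - 1) (2 * N - 1 + 2 * W)
  (N + size (X ++ Y)) (2 * N - 1) t1 s' c' z' N (encode N (X ++ Y)) h1 ltac:(lia) W13 szE (erefl _).
have [k lek ek] : runs prog ((100 + 7 * N) + ((2 * n * (N * (8 * n + 18) + 7) + 1) + (7 * (2 * W) + 300)))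
    (0, mkseq m 14, m) (121, l, h).
  apply: runs_trans r1 _; rewrite size_cat szY -/n addnn -mul2n in r2 r3.
  by apply: (runs_from (runs_trans r2 r3)) => //; rewrite /N; regs_eq.
(* Time and output size are at most [2 ^ 12 * n.+1 ^ 3]; as [2 <= n.+1], the constant is absorbed
   into the exponent. *)
have le_pow : 2 ^ 12 * n.+1 ^ 3 <= n.+1 ^ 15.
  by rewrite (expnD _ 12 3) leq_mul2r leq_exp2r // ltnS n0 orbT.
exists (mem_of l h); split.
- apply: (exec_run (c := (0, m)) (c' := (121, mem_of l h)) (t := k)) => //.
    by move: ek; rewrite /= mem_of_mkseq.
  apply: leq_trans lek _; apply: leq_trans le_pow.
  by move: leW; rewrite /N; nia.
- rewrite /out_x mem0; apply: (@eq_from_nth _ 0); rewrite size_mkseq // => i lti.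
  rewrite nth_mkseq // memE; last by lia.
  by rewrite encode_cat nth_cat szEX lti.
- rewrite /out_y mem0; apply: (@eq_from_nth _ 0); rewrite size_mkseq // => i lti.
  rewrite nth_mkseq // addnS memE; last by lia.
  by rewrite encode_cat nth_cat szEX ltnNge leq_addr addKn.
- rewrite szEX; apply: leq_trans le_pow; move: leW; rewrite /N; nia.
Qed.

(** At most [b] flips suffice on one side, hence on both, so no distance exceeds [b] and only such
    [k] need comparing. Decoding is available only for small [k]. *)
Lemma flipdist_transfer (T U : Type) (X Y : seq T) (x y : seq U) b :
  (exists2 k, k <= b & reach k X Y) ->
  (forall k, k <= b -> reach k X Y <-> reach k x y) ->
  forall D, flipdist X Y D <-> flipdist x y D.
Proof.
move=> [k lek rk] eqr.
have minle V (v w : seq V) D : reach k v w -> flipdist v w D -> D <= b.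
  move=> r [_ minD]; apply: leq_trans lek; rewrite leqNgt; apply/negP => lt.
  exact: (minD k).
move=> D; split=> dD; have leD : D <= b.
- exact: minle dD.
- case: dD => r minD; split=> [|j ltj]; first exact/eqr.
  by rewrite -eqr; [apply: minD|lia].
- by apply: minle dD; apply/eqr.
- case: dD => r minD; split=> [|j ltj]; first exact/eqr.
  by rewrite eqr; [apply: minD|lia].
Qed.

Theorem theorem6p2 :
  exists (P : program) (c k : nat),
    forall X Y : seq nat,
      compatible X Y ->
      all (fun s => s < size X) X ->
      exists mem : memory,
        run P (c * (size X).+1 ^ k) (0, init_mem X Y) = Some mem /\
        [/\ binary (out_x mem), binary (out_y mem),
            compatible (out_x mem) (out_y mem),
            size (out_x mem) <= c * (size X).+1 ^ k &
            forall D, flipdist X Y D <-> flipdist (out_x mem) (out_y mem) D].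
Proof.
exists prog, 1, 15 => X Y XY Xn; rewrite mul1n.
have szXY := perm_size XY.
(* On empty input the first jump leads straight to the halt, and both outputs are empty. *)
have [X0|X_gt0] := posnP (size X).
  move: szXY; rewrite X0 => /esym/size0nil ->; rewrite (size0nil X0).
  by exists (init_mem [::] [::]).
have [mem [runE outx outy leE]] := prog_correct XY X_gt0 Xn.
exists mem; rewrite outx outy; split=> //; split=> //; try exact: binary_encode.
  exact: perm_encode.
(* The bound [2 * size X] lies below the number [32 * size X] of copies, as [reach_decode]
   requires. *)
apply: (flipdist_transfer (perm_reach XY)) => k lek; split; first by apply: reach_encode; rewrite muln_gt0.
by apply: reach_decode => //; apply: leq_ltn_trans lek _; rewrite ltn_pmul2r.
Qed.
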